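(* Let $(\bar{S},\bar{D})$ be an $(N+1)$-dimensional securities market model with gains process $\bar G=\bar S+\bar D$, $d\bar G=\bar\mu\,dt+\bar\sigma\,dW$. Let $\bar b$ be a money market account for $(\bar S,\bar D)$ with value process $M$ and interest rate process $r$, and assume $\bar D\in\mathcal{L}(1/M)$. Then $(\bar{S},\bar{D})$ is instantaneously arbitrage-free if and only if there exists a trading strategy $\bar{\Delta}$ which satisfies the CAPM equation, i.e. such that $$\bar{\mu} - r\bar{S} = b_{\bar{\Delta}}\,\bar{\Delta}(\bar{\mu} - r\bar{S})$$ almost everywhere, where $b_{\bar\Delta}$ is the vector of fundamental betas of the individual securities with respect to $\bar\Delta$.
   Context: Setting: $(\Omega,\mathcal{F},P)$ is a complete probability space with a filtration $\{\mathcal{F}_t\}_{t\in\mathcal{T}}$, where $\mathcal{T}$ is the time interval ($[0,T]$ or $[0,\infty)$), and $W$ is a $K$-dimensional Wiener process relative to the filtration. ''Measurable'' process means jointly measurable on $\Omega\times\mathcal{T}$; ''almost everywhere'' and ''positive measure'' refer to the product of $P$ and Lebesgue measure on $\Omega\times\mathcal{T}$. $\mathcal{L}^1$ (resp. $\mathcal{L}^2$) is the set of adapted, measurable, pathwise integrable (resp. pathwise square integrable) processes (over each $[0,t]$, $t\in\mathcal T$). Time integrals and stochastic integrals of such processes are understood to be continuous adapted processes, and equality of such processes is up to indistinguishability. Securities market model: a pair $(\bar S,\bar D)$ of adapted measurable $(N+1)$-dimensional (column vector) processes (prices and cumulative dividends) with $\bar D(0)=0$ such that $\bar G=\bar S+\bar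 D$ is an Itô process: $\bar G(t)=\bar G(0)+\int_0^t\bar\mu\,ds+\int_0^t\bar\sigma\,dW$, with $\bar\mu$ an $(N+1)$-dimensional process in $\mathcal{L}^1$ and $\bar\sigma$ an $(N+1)\times K$ matrix-valued process in $\mathcal{L}^2$. A trading strategy is an adapted, measurable $(N+1)$-dimensional row-vector-valued process $\bar\Delta$; its value process is $\bar\Delta\bar S$. $\mathcal{L}(\bar G)$ is the set of trading strategies with $\bar\Delta\bar\mu\in\mathcal{L}^1$, $\bar\Delta\bar\sigma\in\mathcal{L}^2$. A trading strategy $\bar\Delta\in\mathcal{L}(\bar G)$ is self-financing if $\bar\Delta(t)\bar S(t)=\bar\Delta(0)\bar S(0)+\int_0^t\bar\Delta\,d\bar G$ for all $t$. A money market account is a self-financing trading strategy $\bar b$ whose value process $M=\bar b\bar S$ is positive and instantaneously riskless (zero dispersion, i.e. zero $dW$-coefficient). Then $M(t)=M(0)\exp\{\int_0^t r\,ds\}$ for some $r\in\mathcal{L}^1$, the interest rate process. The condition $\bar D\in\mathcal{L}(1/M)$ is equivalent to $\bar D r\in\mathcal{L}^1$. A trading strategy $\bar\Delta$ is instantaneously riskless if $\bar\Delta\bar\sigma=0$ almost everywhere. A zero-value instantaneous arbitrage trading strategy is an instantaneously riskless trading strategy $\bar\Delta$ such that $\bar\Delta\bar S=0$ almost everywhere, $\bar\Delta\bar\mu\ge 0$ almost everywhere, and $\bar\Delta\bar\mu>0$ on a set of positive measure. $(\bar S,\bar D)$ is instantaneously arbitrage-free if there exists no zero-value instantaneous arbitrage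 trading strategy. Fundamental betas: for a trading strategy $\bar\Delta$, $b_{\bar\Delta}=\frac{1}{\bar\Delta\bar\sigma\bar\sigma^\top\bar\Delta^\top}\bar\sigma\bar\sigma^\top\bar\Delta^\top$ (an $(N+1)$-dimensional column vector) where $\bar\Delta\bar\sigma\bar\sigma^\top\bar\Delta^\top\ne 0$, and $b_{\bar\Delta}=0$ otherwise. *)

(* Defs.v *)
From HB Require Import structures.
From mathcomp Require Import all_boot all_order all_algebra.
From mathcomp Require Import all_classical all_reals all_analysis.
Set Implicit Arguments.
Unset Strict Implicit.
Unset Printing Implicit Defensive.
Import Order.TTheory GRing.Theory Num.Theory.
Import numFieldNormedType.Exports.
Local Open Scope classical_set_scope.
Local Open Scope ring_scope.

(* Only the values at times in the time interval TT are ever used. *)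
Definition process (R : realType) (Omega : Type) (m n : nat) :=
  R -> Omega -> 'M[R]_(m, n).

Definition time_interval (R : realType) (TT : set R) : Prop :=
  TT = [set t | 0 <= t] \/
  exists T : R, 0 < T /\ TT = [set t | 0 <= t <= T].

Definition filtration d (Omega : measurableType d) (R : realType)
    (TT : set R) (F : R -> set (set Omega)) : Prop :=
  (forall t, TT t -> sigma_algebra [set: Omega] (F t)) /\
  (forall t, TT t -> F t `<=` measurable) /\
  (forall s t, TT s -> TT t -> s <= t -> F s `<=` F t).

Section Processes.
Context d (Omega : measurableType d) (R : realType).
Variables (P : probability Omega R) (TT : set R) (F : R -> set (set Omega)).
Local Notation leb := (@lebesgue_measure R).
Local Notation process := (process R Omega).

Definition ae_product (Q : R -> Omega -> Prop) : Prop :=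
  {ae (P \x leb)%E, forall p : Omega * R, TT p.2 -> Q p.2 p.1}.

Definition measurable_wrt (G : set (set Omega)) m n
    (Y : Omega -> 'M[R]_(m, n)) : Prop :=
  forall i j (B : set R), measurable B -> G [set w | B (Y w i j)].

Definition adapted m n (X : process m n) : Prop :=
  forall t, TT t -> measurable_wrt (F t) (X t).

Definition measurable_process m n (X : process m n) : Prop :=
  forall i j, measurable_fun ([set: Omega] `*` TT)
                (fun p : Omega * R => X p.2 p.1 i j).

Definition adapted_measurable m n (X : process m n) : Prop :=
  adapted X /\ measurable_process X.

Definition continuous_process m n (X : process m n) : Prop :=
  {ae P, forall w, forall i j,
    {within TT, continuous (fun t => X t w i j)}}.

Definition calL1 m n (X : process m n) : Prop :=
  adapted_measurable X /\
  {ae P, forall w, forall t, TT t -> forall i j,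
    leb.-integrable `[0, t] (fun s => (X s w i j)%:E)}.

Definition calL2 m n (X : process m n) : Prop :=
  adapted_measurable X /\
  {ae P, forall w, forall t, TT t -> forall i j,
    leb.-integrable `[0, t] (fun s => (X s w i j ^+ 2)%:E)}.

(* The product formula says at once that, for s < t, the components of
   W t - W s are N(0, t - s), mutually independent, and jointly independent of
   F s; the second parameter of normal_prob is the standard deviation. *)
Definition wiener_process K (W : process K 1) : Prop :=
  [/\ adapted W,
      continuous_process W,
      {ae P, forall w, W 0 w = 0} &
      forall s t, TT s -> TT t -> s < t ->
      forall (A : set Omega) (B : 'I_K -> set R),
        F s A -> (forall k, measurable (B k)) ->
        P (A `&` [set w | forall k, B k ((W t w - W s w) k 0)]) =
        (P A * \prod_(k < K) normal_prob 0 (Num.sqrt (t - s)) (B k))%E].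

Definition cvg0_in_probability (Y : nat -> Omega -> \bar R) : Prop :=
  forall e : R, 0 < e ->
    P [set w | (e%:E <= `|Y k w|)%E] @[k --> \oo] --> 0%E.

(* The process \sum_(i < size) coef i * 1_(times i, times i.+1]. *)
Record simple_process (m n : nat) := SimpleProcess {
  sp_size : nat;
  sp_times : nat -> R;
  sp_coef : nat -> Omega -> 'M[R]_(m, n)
}.

Definition simple_wf m n (H : simple_process m n) : Prop :=
  [/\ forall i, (i <= sp_size H)%N -> TT (sp_times H i),
      forall i, (i < sp_size H)%N -> sp_times H i <= sp_times H i.+1,
      forall i, (i < sp_size H)%N ->
        measurable_wrt (F (sp_times H i)) (sp_coef H i) &
      exists C : R, forall i w j k, (i < sp_size H)%N ->
        `|sp_coef H i w j k| <= C].

Definition simple_value m n (H : simple_process m n) : process m n :=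
  fun t w => \sum_(i < sp_size H)
    (if sp_times H i < t <= sp_times H i.+1 then sp_coef H i w else 0).

Definition simple_integral m K (W : process K 1) (H : simple_process m K) :
    process m 1 :=
  fun t w => \sum_(i < sp_size H)
    sp_coef H i w *m (W (Num.min t (sp_times H i.+1)) w
                      - W (Num.min t (sp_times H i)) w).

Definition simple_approx m n (X : process m n)
    (H : nat -> simple_process m n) : Prop :=
  (forall k, simple_wf (H k)) /\
  forall t, TT t -> forall i j, cvg0_in_probability (fun k w =>
    (\int[leb]_(s in `[0%R, t])
       ((simple_value (H k) s w i j - X s w i j) ^+ 2)%:E)%E).

(* I is a version of \int_0^t X dW: a continuous adapted process which is the
   limit in probability of the elementary integrals of simple processes tending
   to X, along every approximating sequence. Approximating sequences always
   exist for X in calL2 and the limit does not depend on the sequence; the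
   existence clause only rules out vacuity. *)
Definition stochastic_integral m K (W : process K 1) (X : process m K)
    (I : process m 1) : Prop :=
  [/\ adapted I, continuous_process I,
      exists H, simple_approx X H &
      forall H, simple_approx X H -> forall t, TT t -> forall i,
        cvg0_in_probability (fun k w =>
          (simple_integral W (H k) t w i 0 - I t w i 0)%:E)].

Definition time_integral m (X A : process m 1) : Prop :=
  [/\ adapted A, continuous_process A &
      {ae P, forall w, forall t, TT t -> forall i,
        A t w i 0 = (\int[leb]_(s in `[0%R, t]) X s w i 0)%R}].

(* dX = mu dt + sigma dW, up to indistinguishability *)
Definition ito_process m K (W : process K 1) (X : process m 1)
    (mu : process m 1) (sigma : process m K) : Prop :=
  [/\ calL1 mu, calL2 sigma &
      exists A I : process m 1,
        [/\ time_integral mu A, stochastic_integral W sigma I &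
            {ae P, forall w, forall t, TT t ->
              X t w = X 0 w + A t w + I t w}]].

(* Delta \in L(X), for X an Ito process with dX = mu dt + sigma dW *)
Definition calL_ito p n K (mu : process n 1) (sigma : process n K)
    (Delta : process p n) : Prop :=
  [/\ adapted_measurable Delta,
      calL1 (fun t w => Delta t w *m mu t w) &
      calL2 (fun t w => Delta t w *m sigma t w)].

Section Model.
Context (N K : nat) (W : process K 1).
Variables (S D mu : process N.+1 1) (sigma : process N.+1 K).

Definition securities_market_model : Prop :=
  [/\ adapted_measurable S,
      adapted_measurable D,
      {ae P, forall w, D 0 w = 0} &
      ito_process W (fun t w => S t w + D t w) mu sigma].

Definition trading_strategy (Delta : process 1 N.+1) : Prop :=
  adapted_measurable Delta.

Definition value_process (Delta : process 1 N.+1) : process 1 1 :=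
  fun t w => Delta t w *m S t w.

(* \int Delta dG is \int Delta mu dt + \int Delta sigma dW, so that the value
   process is an Ito process with drift Delta mu and dispersion Delta sigma. *)
Definition self_financing (Delta : process 1 N.+1) : Prop :=
  calL_ito mu sigma Delta /\
  ito_process W (value_process Delta)
    (fun t w => Delta t w *m mu t w) (fun t w => Delta t w *m sigma t w).

Definition instantaneously_riskless (Delta : process 1 N.+1) : Prop :=
  ae_product (fun t w => Delta t w *m sigma t w = 0).

(* For a self-financing strategy b, the dispersion of the value process is
   b sigma; see self_financing. *)
Definition money_market_account (b : process 1 N.+1) : Prop :=
  [/\ trading_strategy b,
      self_financing b,
      {ae P, forall w, forall t, TT t -> 0 < value_process b t w 0 0} &
      instantaneously_riskless b].

Definition interest_rate_process (b : process 1 N.+1) (r : process 1 1) :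
    Prop :=
  calL1 r /\
  {ae P, forall w, forall t, TT t ->
    value_process b t w 0 0 =
    value_process b 0 w 0 0 * expR (\int[leb]_(s in `[0%R, t]) r s w 0 0)%R}.

(* D \in L(1/M), where M is the value process of b and 1/M is regarded as a
   one-dimensional Ito process *)
Definition dividends_in_calL_inv (b : process 1 N.+1) : Prop :=
  exists (a : process 1 1) (s : process 1 K),
    ito_process W (fun t w => ((value_process b t w 0 0)^-1)%:M) a s /\
    calL_ito a s D.

Definition zero_value_instantaneous_arbitrage (Delta : process 1 N.+1) :
    Prop :=
  [/\ trading_strategy Delta,
      instantaneously_riskless Delta,
      ae_product (fun t w => Delta t w *m S t w = 0),
      ae_product (fun t w => 0 <= (Delta t w *m mu t w) 0 0) &
      (0 < (P \x leb) [set p : Omega * R |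
         TT p.2 /\ (0 < (Delta p.2 p.1 *m mu p.2 p.1) 0 0)%R])%E].

Definition instantaneously_arbitrage_free : Prop :=
  ~ exists Delta, zero_value_instantaneous_arbitrage Delta.

Definition fundamental_betas (Delta : process 1 N.+1) : process N.+1 1 :=
  fun t w =>
    let v := (Delta t w *m sigma t w *m (sigma t w)^T *m (Delta t w)^T) 0 0 in
    if v == 0 then 0
    else v^-1 *: (sigma t w *m (sigma t w)^T *m (Delta t w)^T).

Definition capm_equation (r : process 1 1) (Delta : process 1 N.+1) : Prop :=
  ae_product (fun t w =>
    let excess := mu t w - r t w 0 0 *: S t w in
    excess = fundamental_betas Delta t w *m (Delta t w *m excess)).

End Model.
End Processes.

(* Main.v *)
Require Import Defs.
From mathcomp Require Import all_boot all_order all_algebra.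
From mathcomp Require Import all_classical all_reals all_analysis.
From mathcomp Require Import measurable_realfun.
Set Implicit Arguments.
Unset Strict Implicit.
Unset Printing Implicit Defensive.
Import Order.TTheory GRing.Theory Num.Theory.
Import numFieldNormedType.Exports.
Local Open Scope classical_set_scope.
Local Open Scope ring_scope.

(* Let e = mu - r S be the excess drift. At every (t, w), decompose e
   orthogonally as f - sigma sigma^T h with f in the kernel of sigma^T. Taking f
   as a portfolio and financing it with the money market account b yields the
   riskless zero-value strategy f^T - (f^T S / b S) b; as b mu = r (b S) almost
   everywhere, its drift is f^T e = |f|^2. Hence the absence of arbitrage forces
   f = 0, i.e. e = - sigma sigma^T h, and then h^T satisfies the CAPM equation.
   Conversely, a riskless zero-value strategy annihilates the betas and S, hence
   annihilates mu as soon as the CAPM equation holds.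
   The identity b mu = r (b S) comes from differentiating
   M(0) exp(int r) = M(0) + int b mu at Lebesgue points, the stochastic integral
   of b sigma = 0 being zero. *)

(** * Measurable least squares *)

Section SquaredNorm.
Context (R : realFieldType) (n : nat).
Implicit Types u : 'cV[R]_n.

Lemma sqnormE u : (u^T *m u) 0 0 = \sum_i u i 0 ^+ 2.
Proof. by rewrite mxE; apply: eq_bigr => i _; rewrite mxE expr2. Qed.

Lemma sqnorm_ge0 u : 0 <= (u^T *m u) 0 0.
Proof. by rewrite sqnormE sumr_ge0// => i _; exact: sqr_ge0. Qed.

Lemma sqnorm_eq0 u : (u^T *m u) 0 0 = 0 -> u = 0.
Proof.
rewrite sqnormE => /psumr_eq0P u0; apply/matrixP => i j.
rewrite ord1 mxE; apply/eqP; rewrite -sqrf_eq0; apply/eqP.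
by apply: u0 => // k _; exact: sqr_ge0.
Qed.

End SquaredNorm.

(** Multiplying by [u^T] on the left turns the hypothesis into the vanishing of the squared norm of
    [A^T *m u]. *)
Lemma mulmx_tr_eq0 (R : realFieldType) m n (A : 'M[R]_(m, n)) (u : 'cV[R]_m) :
  A *m A^T *m u = 0 -> A^T *m u = 0.
Proof.
move=> Au0; apply: sqnorm_eq0.
by rewrite trmx_mul trmxK -mulmxA [X in u^T *m X]mulmxA Au0 mulmx0 mxE.
Qed.

(** Inversion is continuous on the open set of nonzero reals, and any function on the single point 0
    is measurable. *)
Lemma measurable_funV d (T : measurableType d) (R : realType) (D : set T)
  (f : T -> R) : measurable_fun D f -> measurable_fun D (fun x => (f x)^-1).
Proof.
suff mV : measurable_fun [set: R] (@GRing.inv R) by exact: measurableT_comp.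
have -> : [set: R] = [set~ 0] `|` [set 0] by rewrite setUC setUv.
apply/measurable_funU => //; first exact: measurableC.
split; last exact: measurable_fun_set1.
apply: open_continuous_measurable_fun.
  by apply: closed_openC; exact: closed_eq.
by move=> x; rewrite inE => /eqP x0; exact: inv_continuous.
Qed.

(** Formulated over an arbitrary measurable type, so that the same closure lemmas serve for
    [F t]-measurability at a fixed time and for joint measurability. *)
Definition measurable_mx d (T : measurableType d) (R : realType) (D : set T)
    m n (A : T -> 'M[R]_(m, n)) :=
  forall i j, measurable_fun D (fun x => A x i j).

Section MeasurableMatrix.
Context d (T : measurableType d) (R : realType) (D : set T).

Lemma measurable_mx_tr m n (A : T -> 'M[R]_(m, n)) :
  measurable_mx D A -> measurable_mx D (fun x => (A x)^T).
Proof. by move=> mA i j; under eq_fun do rewrite mxE; exact: mA. Qed.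

Lemma measurable_mxD m n (A B : T -> 'M[R]_(m, n)) : measurable_mx D A ->
  measurable_mx D B -> measurable_mx D (fun x => A x + B x).
Proof.
move=> mA mB i j; under eq_fun do rewrite mxE.
by apply: measurable_funD; [exact: mA|exact: mB].
Qed.

Lemma measurable_mxZ m n (c : T -> R) (A : T -> 'M[R]_(m, n)) :
  measurable_fun D c -> measurable_mx D A ->
  measurable_mx D (fun x => c x *: A x).
Proof.
move=> mc mA i j; under eq_fun do rewrite mxE.
by apply: measurable_funM => //; exact: mA.
Qed.

Lemma measurable_mxB m n (A B : T -> 'M[R]_(m, n)) : measurable_mx D A ->
  measurable_mx D B -> measurable_mx D (fun x => A x - B x).
Proof.
move=> mA mB i j; under eq_fun do rewrite !mxE.
by apply: measurable_funB; [exact: mA|exact: mB].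
Qed.

Lemma measurable_mxM m n p (A : T -> 'M[R]_(m, n)) (B : T -> 'M[R]_(n, p)) :
  measurable_mx D A -> measurable_mx D B ->
  measurable_mx D (fun x => A x *m B x).
Proof.
move=> mA mB i j; under eq_fun do rewrite mxE.
apply: measurable_sum => k.
by apply: measurable_funM; [exact: mA|exact: mB].
Qed.

End MeasurableMatrix.

(* Gram-Schmidt, one column of A at a time: phi is then made of field operations
   only, hence measurable. A column already in the span of the following ones
   has zero residual, and the convention x / 0 = 0 gives it coefficient 0. *)
Lemma measurable_least_squares (R : realType) n K :
  exists phi : 'M[R]_(n, K) -> 'cV[R]_n -> 'cV[R]_K,
    (forall A (e : 'cV_n), A^T *m (e + A *m phi A e) = 0) /\
    forall d (T : measurableType d) (D : set T) A e,
      measurable_mx D A -> measurable_mx D e ->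
      measurable_mx D (fun x => phi (A x) (e x)).
Proof.
elim: K => [|K [psi [psiP mpsi]]].
  exists (fun _ _ => 0); split => [A e|d T D A e _ _ i j].
    exact: flatmx0.
  exact: measurable_cst.
pose hd (A : 'M[R]_(n, 1 + K)) : 'cV_n := lsubmx A.
pose tl (A : 'M[R]_(n, 1 + K)) : 'M[R]_(n, K) := rsubmx A.
(* [psi] returns minus the regression coefficients, so [res A e] is the residual of [e], orthogonal
   to the columns of [A]. *)
pose res A (e : 'cV[R]_n) := e + A *m psi A e.
(* Projection coefficient of the residual of [e] on the residual of the first column, both taken
   with respect to the other columns. *)
pose coef (A : 'M[R]_(n, 1 + K)) (e : 'cV[R]_n) :=
  let a := res (tl A) (hd A) in
  (a^T *m res (tl A) e) 0 0 / (a^T *m a) 0 0.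
pose phi A e : 'cV[R]_(1 + K) := col_mx (- (coef A e)%:M)
  (psi (tl A) e - coef A e *: psi (tl A) (hd A)).
suff phiP A e : A^T *m (e + A *m phi A e) = 0.
  exists phi; split; first exact: phiP.
  move=> d T D A e mA me.
  have mhd : measurable_mx D (fun x => hd (A x)).
    by move=> i j; under eq_fun do rewrite mxE; exact: mA.
  have mtl : measurable_mx D (fun x => tl (A x)).
    by move=> i j; under eq_fun do rewrite mxE; exact: mA.
  have mres u : measurable_mx D u ->
      measurable_mx D (fun x => res (tl (A x)) (u x)).
    move=> mu; apply: measurable_mxD => //; apply: measurable_mxM => //.
    exact: mpsi.
  have mdot (u v : T -> 'cV[R]_n) : measurable_mx D u -> measurable_mx D v ->
      measurable_fun D (fun x => ((u x)^T *m v x) 0 0).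
    move=> mu mv.
    exact: (measurable_mxM (measurable_mx_tr mu) mv).
  have mcoef : measurable_fun D (fun x => coef (A x) (e x)).
    apply: measurable_funM; last apply: measurable_funV.
      by apply: mdot; exact: mres.
    by apply: mdot; exact: mres.
  suff mphi (i : 'I_(1 + K)) : measurable_fun D (fun x => phi (A x) (e x) i 0).
    by move=> i j; rewrite ord1; exact: mphi.
  rewrite -(splitK i); case: fintype.split => k /=.
    apply: (eq_measurable_fun (fun x => - coef (A x) (e x))).
      by move=> x _; rewrite /phi col_mxEu ord1 mxE mxE eqxx.
    exact: measurableT_comp.
  under eq_fun do rewrite /phi col_mxEd.
  apply: measurable_mxB; first exact: mpsi.
  by apply: measurable_mxZ => //; exact: mpsi.
rewrite /phi; set t := coef A e; set a := hd A; set B := tl A.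
have -> : A = row_mx a B by rewrite hsubmxK.
set f := (_ + _).
have fE : f = res B e - t *: res B a.
  rewrite /f /res mul_row_col mulmxN mul_mx_scalar mulmxBr.
  by rewrite -scalemxAr scalerDr opprD -!addrA; congr (_ + _); rewrite addrCA.
have Bf : B^T *m f = 0.
  by rewrite fE mulmxBr -scalemxAr !psiP scaler0 subrr.
rewrite tr_row_mx mul_col_mx Bf.
suff -> : a^T *m f = 0 by rewrite col_mx0.
(* [a] and its residual differ by a combination of the columns of [B], to which [f] is
   orthogonal. *)
have -> : a^T *m f = (res B a)^T *m f.
  have -> : (res B a)^T = a^T + (psi B a)^T *m B^T.
    by rewrite raddfD /= trmx_mul.
  by rewrite mulmxDl -mulmxA Bf mulmx0 addr0.
rewrite fE mulmxBr -scalemxAr /t /coef -/a -/B.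
have [a0|a0] := eqVneq (((res B a)^T *m res B a) 0 0) 0.
  by rewrite (sqnorm_eq0 a0) trmx0 !mul0mx scaler0 subrr.
apply/eqP; rewrite subr_eq0; apply/eqP/matrixP => i j.
by rewrite !ord1 [RHS]mxE divfK.
Qed.

(** * Adapted processes and null sets of the product measure *)

Section AdaptedMeasurable.
Context d (Omega : measurableType d) (R : realType).
Variables (TT : set R) (F : R -> set (set Omega)).
Hypothesis F_filtration : filtration TT F.
Local Notation process := (process R Omega).

(** Each [F t] is already a sigma-algebra, so generating one from it adds nothing; adaptedness
    becomes measurability for a genuine measurable type. *)
Lemma adapted_measurableP m n (X : process m n) :
  adapted_measurable TT F X <->
  (forall t, TT t ->
     measurable_mx (setT : set (g_sigma_algebraType (F t))) (X t)) /\
  measurable_mx ([set: Omega] `*` TT) (fun p : Omega * R => X p.2 p.1).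
Proof.
have [F_sigma _] := F_filtration.
split=> -[aX mX]; split=> // t /[dup] Tt /F_sigma /sigma_algebra_id FE i j.
  by move=> _ B mB; rewrite setTI /measurable/= FE; exact: aX.
move=> B mB; rewrite -FE.
by have := aX t Tt i j measurableT B mB; rewrite setTI.
Qed.

Lemma adapted_measurable_tr m n (X : process m n) :
  adapted_measurable TT F X ->
  adapted_measurable TT F (fun t w => (X t w)^T).
Proof.
move=> /adapted_measurableP[aX mX]; apply/adapted_measurableP; split=> [t Tt|].
  by apply: measurable_mx_tr; exact: aX.
exact: measurable_mx_tr.
Qed.

Lemma adapted_measurableB m n (X Y : process m n) :
  adapted_measurable TT F X -> adapted_measurable TT F Y ->
  adapted_measurable TT F (fun t w => X t w - Y t w).
Proof.
move=> /adapted_measurableP[aX mX] /adapted_measurableP[aY mY].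
apply/adapted_measurableP; split=> [t Tt|].
  by apply: measurable_mxB; [exact: aX|exact: aY].
exact: measurable_mxB.
Qed.

Lemma adapted_measurableD m n (X Y : process m n) :
  adapted_measurable TT F X -> adapted_measurable TT F Y ->
  adapted_measurable TT F (fun t w => X t w + Y t w).
Proof.
move=> /adapted_measurableP[aX mX] /adapted_measurableP[aY mY].
apply/adapted_measurableP; split=> [t Tt|].
  by apply: measurable_mxD; [exact: aX|exact: aY].
exact: measurable_mxD.
Qed.

Lemma adapted_measurableM m n p (X : process m n) (Y : process n p) :
  adapted_measurable TT F X -> adapted_measurable TT F Y ->
  adapted_measurable TT F (fun t w => X t w *m Y t w).
Proof.
move=> /adapted_measurableP[aX mX] /adapted_measurableP[aY mY].
apply/adapted_measurableP; split=> [t Tt|].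
  by apply: measurable_mxM; [exact: aX|exact: aY].
exact: measurable_mxM.
Qed.

Lemma adapted_measurableZ m n (c : process 1 1) (X : process m n) :
  adapted_measurable TT F c -> adapted_measurable TT F X ->
  adapted_measurable TT F (fun t w => c t w 0 0 *: X t w).
Proof.
move=> /adapted_measurableP[ac mc] /adapted_measurableP[aX mX].
apply/adapted_measurableP; split=> [t Tt|].
  by apply: measurable_mxZ; [exact: ac|exact: aX].
by apply: measurable_mxZ => //; exact: mc.
Qed.

Lemma adapted_measurableV (c : process 1 1) :
  adapted_measurable TT F c ->
  adapted_measurable TT F (fun t w => ((c t w 0 0)^-1)%:M : 'M[R]_1).
Proof.
have inv1 (T : Type) (a : T -> 'M[R]_1) i j :
    (fun x => ((a x 0 0)^-1%:M : 'M[R]_1) i j) = (fun x => (a x 0 0)^-1).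
  by apply/funext => x; rewrite (ord1 i) (ord1 j) mxE eqxx.
move=> /adapted_measurableP[ac mc].
apply/adapted_measurableP; split=> [t Tt|] i j.
  by rewrite inv1; apply: measurable_funV; exact: ac.
rewrite (inv1 _ (fun p : Omega * R => c p.2 p.1)).
by apply: measurable_funV; exact: mc.
Qed.

Lemma adapted_measurable_least_squares n K :
  exists phi : 'M[R]_(n, K) -> 'cV[R]_n -> 'cV[R]_K,
    (forall A e, A^T *m (e + A *m phi A e) = 0) /\
    forall (A : process n K) (e : process n 1),
      adapted_measurable TT F A -> adapted_measurable TT F e ->
      adapted_measurable TT F (fun t w => phi (A t w) (e t w)).
Proof.
have [phi [phiP mphi]] := @measurable_least_squares R n K.
exists phi; split=> // A e.
move=> /adapted_measurableP[aA mA] /adapted_measurableP[ae me].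
apply/adapted_measurableP; split=> [t Tt|].
  by apply: mphi; [exact: aA|exact: ae].
exact: mphi.
Qed.

End AdaptedMeasurable.

(** * Almost everywhere statements for the product measure and along sections *)

Section ProductNullSets.
Context d (Omega : measurableType d) (R : realType).
Variables (P : probability Omega R) (TT : set R).
Local Notation leb := (@lebesgue_measure R).
Implicit Types Q : R -> Omega -> Prop.

Lemma ae_product_filter : Filter (almost_everywhere (P \x leb)%E).
Proof.
exact: (ae_filter_ringOfSetsType
  ((P \x leb)%E : {measure set (_ * _) -> \bar R})).
Qed.

Lemma ae_productS Q1 Q2 : (forall t w, TT t -> Q1 t w -> Q2 t w) ->
  ae_product P TT Q1 -> ae_product P TT Q2.
Proof.
move=> Q12; apply: (@filterS _ _ ae_product_filter) => p Qp Tp; exact/Q12/Qp.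
Qed.

Lemma ae_productI Q1 Q2 : ae_product P TT Q1 -> ae_product P TT Q2 ->
  ae_product P TT (fun t w => Q1 t w /\ Q2 t w).
Proof.
apply: (@filterS2 _ _ ae_product_filter) => p Q1p Q2p Tp.
by split; [exact: Q1p|exact: Q2p].
Qed.

Lemma ae_product_of_ae Q : {ae P, forall w, forall t, TT t -> Q t w} ->
  ae_product P TT Q.
Proof.
move=> [B [mB PB0 QB]]; exists (B `*` setT); split.
- exact: measurableX.
- rewrite (product_measure1E P)//.
  (* The real line has infinite measure, so the convention that 0 times infinity is 0 matters
     here. *)
  by rewrite [X in (X * _)%E](PB0 : _ = 0%E) mul0e.
- move=> [w t] /= /not_implyP[Tt nQ]; split=> //; apply: QB => /= Qw.
  exact/nQ/Qw.
Qed.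

(** Tonelli: the measure of a null set covering the exceptions is the [P]-integral of the
    nonnegative measures of its sections, so almost all of these vanish. *)
Lemma ae_product_sections Q : ae_product P TT Q ->
  {ae P, forall w, {ae leb, forall t, TT t -> Q t w}}.
Proof.
move=> [B [mB PB0 QB]].
have mf : measurable_fun setT (leb \o xsection B).
  exact: measurable_fun_xsection.
have /ae_eq_integral_abs : (\int[P]_w `|(leb \o xsection B) w| = 0)%E.
  by rewrite -PB0; apply: eq_integral => w _; rewrite gee0_abs.
move=> /(_ measurableT mf); apply: filterS => w /(_ I) Bw0.
exists (xsection B w); split=> //; first exact: measurable_xsection.
by move=> t nQ; rewrite /xsection/= inE; exact: (QB (w, t)).
Qed.

(** Tonelli in the other direction; measurability of the exceptional set is what lets its measure be
    computed from its sections. *)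
Lemma sections_ae_product Q :
  measurable [set p : Omega * R | TT p.2 /\ ~ Q p.2 p.1] ->
  {ae P, forall w, {ae leb, forall t, TT t -> Q t w}} -> ae_product P TT Q.
Proof.
set E := [set p | _] => mE aeQ; exists E; split=> //.
  have mf : measurable_fun setT (leb \o xsection E).
    exact: measurable_fun_xsection.
  rewrite [LHS](_ : _ = \int[P]_w `|(leb \o xsection E) w|)%E; last first.
    by apply: eq_integral => w _; rewrite gee0_abs.
  apply/ae_eq_integral_abs => //; apply: filterS aeQ => w [B [mB B0 QB]] _ /=.
  apply: (subset_measure0 _ mB _ B0); first exact: measurable_xsection.
  move=> t; rewrite /xsection /= inE => -[Tt nQ]; apply: QB => /= Qt.
  exact/nQ/Qt.
by move=> p /= /not_implyP.
Qed.

End ProductNullSets.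

(** * The drift of a money market account *)

Section StochasticIntegral0.
Context d (Omega : measurableType d) (R : realType).
Variables (P : probability Omega R) (TT : set R) (F : R -> set (set Omega)).
Local Notation leb := (@lebesgue_measure R).
Local Notation process := (process R Omega).
Hypotheses (complete_P : measure_is_complete P)
  (TT_interval : time_interval TT) (F_filtration : filtration TT F).

Lemma time_interval0 : TT 0.
Proof. by case: TT_interval => [|[T [T0]]] ->; rewrite /= lexx ?ltW. Qed.

Lemma time_interval_itv T : TT T -> `[0, T] `<=` TT.
Proof.
case: TT_interval => [|[T' [T'0]]] -> /= => [T0|/andP[T0 TT']] t /=;
  rewrite in_itv/= => /andP[-> tT] //=.
exact: le_trans TT'.
Qed.

(** For a constant sequence the limit says that each event [e <= |Y|] has probability 0; the
    countably many values [1 / (n + 1)] of [e] suffice. *)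
Lemma cvg0_in_probability_cst (Y : Omega -> R) : measurable_fun setT Y ->
  cvg0_in_probability P (fun _ w => (Y w)%:E) -> {ae P, forall w, Y w = 0}.
Proof.
move=> mY Y0.
have : {ae P, forall w, forall n, ~ (n.+1%:R^-1 <= `|Y w|)}.
  apply: ae_foralln => n.
  have /Y0/(cvg_unique _)/(_ (cvg_cst _)) : 0 < n.+1%:R^-1 :> R.
    by rewrite invr_gt0.
  move=> PY; exists [set w | n.+1%:R^-1 <= `|Y w|]; split.
  - rewrite -[X in measurable X]setTI.
    have mYn : measurable_fun setT (fun w => `|Y w|).
      exact: measurableT_comp (@normr_measurable R setT) mY.
    exact: (measurable_fun_ler (measurable_cst _) mYn) measurableT [set true] _.
  - by rewrite PY.
  - by move=> w /= /contrapT.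
apply: filterS => w Yw; apply: contrapT => /eqP; rewrite -normr_gt0 => Yw0.
apply: (Yw (Num.truncn (`|Y w|^-1))).
by rewrite invf_ple ?posrE ?ltr0n// ltW// truncnS_gt.
Qed.

(** At each fixed time [I] vanishes almost surely; a single null set serves all rational times, and
    path continuity extends the result to all interior times, where a whole neighbourhood lies in
    [TT]. *)
Lemma stochastic_integral_eq0 m K (W : process K 1) (X : process m K)
    (I : process m 1) : calL2 P TT F X -> stochastic_integral P TT F W X I ->
  ae_product P TT (fun t w => X t w = 0) ->
  {ae P, forall w, forall t T, TT T -> 0 < t < T -> I t w = 0}.
Proof.
move=> [_ X2] [aI cI _ IE] X0.
(* H is the empty simple process: its integrals vanish and it approximates X. *)
pose H := SimpleProcess 0 (fun=> 0) (fun _ _ => 0) :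
  simple_process Omega R m K.
have IH : simple_approx P TT F X (fun=> H).
  split=> [_|t Tt i j e e0].
    split=> //=; first by move=> i _; exact: time_interval0.
    by exists 0.
  pose Y w := (\int[leb]_(s in `[0%R, t])
    ((simple_value H s w i j - X s w i j) ^+ 2)%:E)%E.
  have Y0 : {ae P, forall w, Y w = 0%E}.
    move: (ae_product_sections X0) X2.
    apply: filterS2 => w X0w /(_ t Tt i j) X2w.
    have YE : Y w = (\int[leb]_(s in `[0%R, t]) (X s w i j ^+ 2)%:E)%E.
      apply: eq_integral => s _.
      by rewrite /simple_value big_ord0 mxE sub0r sqrrN.
    rewrite YE (ae_eq_integral (cst 0%E)) ?integral0//.
      by case/integrableP : X2w.
    apply: (@filterS _ _ (ae_filter_ringOfSetsType leb)) X0w => s X0s s0t.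
    by rewrite X0s ?mxE ?expr0n//; exact: time_interval_itv s0t.
  pose Z := [set w | (e%:E <= `|Y w|)%E].
  have Z0 : P.-negligible Z.
    apply: negligibleS Y0 => w /= eY; apply: contrapT => /contrapT Yw0.
    by move: eY; rewrite /Z/= Yw0 abse0 lee_fin leNgt e0.
  rewrite [X in X @ _](_ : _ = fun=> 0%E); first exact: cvg_cst.
  (* Completeness of [P] makes the negligible event [Z] measurable, hence of probability 0. *)
  by apply/funext => k; exact: (measure_negligible (complete_P Z0) Z0).
have I0 t i : TT t -> {ae P, forall w, I t w i 0 = 0}.
  move=> Tt; apply: cvg0_in_probability_cst.
    move=> _ B mB; rewrite setTI; have [_ [FP _]] := F_filtration.
    exact/(FP t)/aI.
  move=> e e0; rewrite [X in X @ _](_ : _ = fun=> P [set w |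
      (e%:E <= `|(simple_integral W H t w i 0 - I t w i 0)%:E|)%E]).
    exact: (IE _ IH).
  apply/funext => k; congr (P _); apply/funext => w.
  by rewrite /= /simple_integral big_ord0 mxE sub0r normrN.
(* Pairs of a rational time and a row are enumerated by [pickle], so that only countably many null
   sets are joined. *)
have I0q : {ae P, forall w, forall n q i, pickle (q, i) = n ->
    TT (ratr q) -> I (ratr q) w i 0 = 0}.
  apply: ae_foralln => n.
  have [[[q i] qin]|nqi] := pselect (exists qi : rat * 'I_m, pickle qi = n).
    case: (pselect (TT (ratr q))) => [Tq|nTq]; last first.
      apply: aeW => w q' i'.
      by rewrite -qin => /(pcan_inj pickleK)[-> _] /nTq.
    apply: filterS (I0 _ i Tq) => w Iq q' i'.
    by rewrite -qin => /(pcan_inj pickleK)[-> ->].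
  by apply: aeW => w q i qin; exfalso; apply: nqi; exists (q, i).
move: I0q cI; apply: filterS2 => w I0q cI t T TT_T tT.
apply/matrixP => i j; rewrite (ord1 j) mxE; apply: contrapT => /eqP It0.
pose f s := I s w i 0.
have oT : open `]0, T[%classic by exact: interval_open.
have : {within `]0, T[%classic, continuous f}.
  apply: continuous_subspaceW (cI i 0).
  by apply: subset_trans (time_interval_itv TT_T); exact: subset_itv_oo_cc.
rewrite continuous_open_subspace// => /(_ t).
rewrite inE/= => /(_ tT) cf.
(* A nonzero value at [t] would persist on a neighbourhood of [t], which contains a rational
   time. *)
have : \forall s \near t, f s != 0 /\ 0 < s < T.
  near=> s; split; near: s.
    exact: (cvgr_neq0 _ cf It0).
  by apply: (@near_in_itvoo _ 0 T t); rewrite inE/=.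
move=> /nbhs_ballP[e /= e0 He].
have /rat_in_itvoo[q] : t < t + e by rewrite ltrDl.
rewrite in_itv/= => /andP[tq qt].
have [] := He (ratr q).
  by rewrite /ball/= ltr_distl ltrBlDr qt (lt_trans tq)// ltrDl.
move=> fq0 /andP[q0 qT]; move/eqP: fq0; apply.
apply: (I0q _ _ _ erefl); apply: (time_interval_itv TT_T).
by rewrite /= in_itv/= !ltW.
Unshelve. all: by end_near. Qed.

End StochasticIntegral0.

(** * Differentiation of primitives at Lebesgue points *)

Section LebesgueDerivative.
Context (R : realType).
Local Notation leb := (@lebesgue_measure R).

(** Extending [g] by 0 outside [[0, T]] gives an integrable function on the line, to which Lebesgue
    differentiation applies; near an interior point both functions have the same primitive. *)
Lemma ae_is_derive_primitive (g : R -> R) (T : R) :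
  leb.-integrable `[0, T] (fun s => (g s)%:E) ->
  {ae leb, forall t, 0 < t < T ->
    is_derive t 1 (fun x => \int[leb]_(s in `[0%R, x]) g s) (g t)}.
Proof.
move=> intg; pose h := g \_ `[0, T].
have inth : leb.-integrable setT (EFin \o h).
  have := (@integrable_mkcond _ _ _ leb _ (EFin \o g)
    (measurable_itv `[0, T])).1 intg.
  by apply: eq_integrable => // x _; rewrite /= restrict_EFin.
have := lebesgue_differentiation (open_integrable_locally openT inth).
apply: (@filterS _ _ (ae_filter_ringOfSetsType leb)) => t ht /andP[t0 tT].
have gE x : x < T ->
    \int[leb]_(s in `[0%R, x]) h s = \int[leb]_(s in `[0%R, x]) g s.
  move=> xT; apply: eq_Rintegral => s; rewrite inE/= in_itv/= => /andP[s0 sx].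
  by rewrite /h patchE ifT// inE/= in_itv/= s0 (le_trans sx)// ltW.
have [||||dF F'] := @FTC1_lebesgue_pt R h (BLeft 0) t T => //.
  exact: integrableS inth.
have htE : h t = g t by rewrite /h patchE ifT// inE/= in_itv/= !ltW.
apply: (@near_eq_is_derive R R^o R^o (fun x => \int[leb]_(s in `[0%R, x]) h s)).
  by near=> x; apply: gE; near: x; exact: lt_nbhsl.
by apply: DeriveDef => //; rewrite -derive1E F'.
Unshelve. all: by end_near. Qed.

(** At almost every [t] both primitives are differentiable; the two sides agree near [t], so the
    chain rule for the exponential and the derivative of the sum give the same number. *)
Lemma ae_exp_primitive (rho beta : R -> R) (m0 T : R) :
  leb.-integrable `[0, T] (fun s => (rho s)%:E) ->
  leb.-integrable `[0, T] (fun s => (beta s)%:E) ->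
  (forall t, 0 < t < T -> m0 * expR (\int[leb]_(s in `[0%R, t]) rho s) =
                          m0 + \int[leb]_(s in `[0%R, t]) beta s) ->
  {ae leb, forall t, 0 < t < T ->
    beta t = rho t * (m0 * expR (\int[leb]_(s in `[0%R, t]) rho s))}.
Proof.
move=> /ae_is_derive_primitive drho /ae_is_derive_primitive dbeta E.
move: drho dbeta; apply: (@filterS2 _ _ (ae_filter_ringOfSetsType leb)).
move=> t + + t0T => /(_ t0T) drho /(_ t0T) dbeta.
set G := (fun x => \int[leb]_(s in `[0%R, x]) rho s) in drho E *.
set B := (fun x => \int[leb]_(s in `[0%R, x]) beta s) in dbeta E *.
have dG : is_derive t 1 (fun x => m0 * expR (G x)) (m0 * (expR (G t) * rho t)).
  have := @is_deriveZ R R^o R^o (expR \o G) m0 t 1 _ (is_derive1_comp _ drho).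
  exact.
have dB : is_derive t 1 (fun x => m0 * expR (G x)) (beta t).
  apply: (@near_eq_is_derive R R^o R^o (fun x => m0 + B x)).
    near=> x; rewrite E//; near: x.
    by apply: (@near_in_itvoo _ 0 T t); rewrite inE/=.
  have := @is_deriveD R R^o R^o (cst m0) B t 1 0 (beta t)
    (is_derive_cst _ _ _) dbeta.
  by rewrite add0r.
have [_ <-] := dB; have [_ ->] := dG.
by rewrite mulrA mulrC.
Unshelve. all: by end_near. Qed.

End LebesgueDerivative.

(** * Almost everywhere statements on the time interval *)

Section TimeInterval.
Context (R : realType) (TT : set R).
Local Notation leb := (@lebesgue_measure R).
Hypothesis TT_interval : time_interval TT.

Lemma measurable_time_interval : measurable TT.
Proof.
case: TT_interval => [|[T [_]]] ->.
  by have := @measurable_itv R `[0, +oo[; rewrite set_itvcy.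
exact: (@measurable_itv R `[0, T]).
Qed.

Lemma ae_neq (a : R) : {ae leb, forall t, t != a}.
Proof.
exists [set a]; split=> //; first by rewrite lebesgue_measure_set1.
by move=> t /= /negP; rewrite negbK => /eqP.
Qed.

(** Endpoints form null sets; up to these, an unbounded time interval is exhausted by the countably
    many []0, n[]. *)
Lemma ae_time_interval (Q : R -> Prop) :
  (forall T, TT T -> {ae leb, forall t, 0 < t < T -> Q t}) ->
  {ae leb, forall t, TT t -> Q t}.
Proof.
have leb_filter := ae_filter_ringOfSetsType leb.
move=> aeQ; case: TT_interval => [TTE|[T [T0 TTE]]].
  have : {ae leb, forall t, forall n, 0 < t < n%:R -> Q t}.
    by apply: ae_foralln => n; apply: aeQ; rewrite TTE/=.
  move: (ae_neq 0); apply: (@filterS2 _ _ leb_filter) => t t0 Qt.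
  rewrite TTE/= => t_ge0; apply: (Qt (Num.bound t)).
  by rewrite lt_neqAle eq_sym t0 t_ge0 archi_boundP.
have : {ae leb, forall t, 0 < t < T -> Q t}.
  by apply: aeQ; rewrite TTE/= lexx ltW.
move: (ae_neq 0) (ae_neq T); apply: (@filterS3 _ _ leb_filter) => t t0 tT Qt.
rewrite TTE/= => /andP[t_ge0 tleT]; apply: Qt.
by rewrite !lt_neqAle tT tleT t_ge0 eq_sym t0.
Qed.

End TimeInterval.

Section Measurability.
Context d (T : measurableType d) (R : realType) (D : set T).
Hypothesis mD : measurable D.

Lemma measurable_set_neq (f g : T -> R) : measurable_fun D f ->
  measurable_fun D g -> measurable (D `&` [set x | f x <> g x]).
Proof.
move=> mf mg.
rewrite [X in _ `&` X](_ : _ = (fun x => f x == g x) @^-1` [set false]).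
  exact: measurable_fun_eqr.
by apply/seteqP; split=> x /= => [/eqP/negbTE|/negbT/eqP].
Qed.

Lemma measurable_set_gt0 (f : T -> R) : measurable_fun D f ->
  measurable (D `&` [set x | 0 < f x]).
Proof.
move=> mf; have m0 : measurable_fun D (cst (0 : R)) by exact: measurable_cst.
exact: (measurable_fun_ltr m0 mf mD (I : measurable [set true])).
Qed.

End Measurability.

(** * Riskless growth of the money market account *)

Section MoneyMarketAccount.
Context d (Omega : measurableType d) (R : realType).
Variables (P : probability Omega R) (TT : set R) (F : R -> set (set Omega)).
Local Notation leb := (@lebesgue_measure R).
Local Notation process := (process R Omega).
Hypotheses (complete_P : measure_is_complete P)
  (TT_interval : time_interval TT) (F_filtration : filtration TT F).

(** The comparison of derivatives is made path by path, then carried to the product measure by joint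
    measurability of both sides. *)
Lemma money_market_account_drift N K (W : process K 1) (S mu : process N.+1 1)
    (sigma : process N.+1 K) (b : process 1 N.+1) (r : process 1 1) :
  adapted_measurable TT F S -> money_market_account P TT F W S mu sigma b ->
  interest_rate_process P TT F S b r ->
  ae_product P TT (fun t w =>
    (b t w *m mu t w) 0 0 = r t w 0 0 * (b t w *m S t w) 0 0).
Proof.
move=> adS [adb [_ [L1bmu L2bs [A [I [[_ _ AE] SI ME]]]]] _ bs0] [L1r MexpE].
have I0 := stochastic_integral_eq0 complete_P TT_interval F_filtration
  L2bs SI bs0.
apply: sections_ae_product.
  have mTT : measurable ([set: Omega] `*` TT).
    by apply: measurableX => //; exact: measurable_time_interval.
  have [_ mbmu] := L1bmu.1; have [_ mr] := L1r.1.
  have [_ mbS] := adapted_measurableM F_filtration adb adS.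
  rewrite [X in measurable X](_ : _ = ([set: Omega] `*` TT) `&` [set p |
      (b p.2 p.1 *m mu p.2 p.1) 0 0 <>
      r p.2 p.1 0 0 * (b p.2 p.1 *m S p.2 p.1) 0 0]); last first.
    by apply/seteqP; split=> p /= [] // [].
  exact: (measurable_set_neq mTT (mbmu 0 0)
    (measurable_funM (mr 0 0) (mbS 0 0))).
move: L1bmu.2 L1r.2 => {}L1bmu {}L1r.
(* A path is fixed outside the null sets of all the almost sure hypotheses; the rest is real
   analysis in [t]. *)
near=> w.
have L1bmu_w : forall t, TT t -> forall i j,
    leb.-integrable `[0, t] (fun s => ((b s w *m mu s w) i j)%:E) by near: w.
have L1r_w : forall t, TT t -> forall i j,
    leb.-integrable `[0, t] (fun s => (r s w i j)%:E) by near: w.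
have AE_w : forall t, TT t -> forall i,
    A t w i 0 = (\int[leb]_(s in `[0%R, t]) (b s w *m mu s w) i 0)%R by near: w.
have ME_w : forall t, TT t -> b t w *m S t w = b 0 w *m S 0 w + A t w + I t w.
  by near: w.
have I0_w : forall t T, TT T -> 0 < t < T -> I t w = 0 by near: w.
have Mexp_w : forall t, TT t -> (b t w *m S t w) 0 0 =
    (b 0 w *m S 0 w) 0 0 * expR (\int[leb]_(s in `[0%R, t]) r s w 0 0)%R.
  by near: w.
apply: ae_time_interval => // T TT_T.
have TTt t : 0 < t < T -> TT t.
  move=> /andP[t0 tT]; apply: (time_interval_itv TT_interval TT_T).
  by rewrite /= in_itv/= !ltW.
have := ae_exp_primitive (L1r_w T TT_T 0 0) (L1bmu_w T TT_T 0 0).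
move=> /(_ ((b 0 w *m S 0 w) 0 0)) ae_eq.
apply: (@filterS _ _ (ae_filter_ringOfSetsType leb)) (ae_eq _).
  by move=> t + /[dup] /TTt /Mexp_w ->.
move=> t /[dup] /TTt Tt t0T.
by rewrite -Mexp_w// ME_w// (I0_w _ _ TT_T t0T) addr0 mxE AE_w.
Unshelve. all: by end_near. Qed.

End MoneyMarketAccount.

(** * Arbitrage and the CAPM equation *)

Section PointwiseCAPM.
Context (R : realType) (n K : nat).
Implicit Types (sigma : 'M[R]_(n, K)) (e S mu : 'cV[R]_n) (Delta b : 'rV[R]_n).

(* fundamental_betas at a fixed (t, w) *)
Definition betas sigma Delta : 'cV[R]_n :=
  let v := (Delta *m sigma *m sigma^T *m Delta^T) 0 0 in
  if v == 0 then 0 else v^-1 *: (sigma *m sigma^T *m Delta^T).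

(** Betas lie in the column space of [sigma], which [Delta'] annihilates. *)
Lemma riskless_mul_betas sigma Delta Delta' :
  Delta' *m sigma = 0 -> Delta' *m betas sigma Delta = 0.
Proof.
move=> Ds0; rewrite /betas; case: ifP => _; first by rewrite mulmx0.
by rewrite -scalemxAr !mulmxA Ds0 !mul0mx scaler0.
Qed.

(** With [u = - e] and [v = h^T u], the betas are [u / v] and [h^T e = - v]. If [v = 0], then [v]
    being the squared norm of [sigma^T h] forces [u = 0], so [e = 0] and the default value of the
    betas does no harm. *)
Lemma betas_span sigma e (h : 'cV_n) : e + sigma *m sigma^T *m h = 0 ->
  e = betas sigma h^T *m (h^T *m e).
Proof.
move=> /eqP; rewrite addr_eq0 => /eqP ->; rewrite /betas trmxK -!mulmxA.
set u := sigma *m _; set v := (h^T *m u) 0 0.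
have [v0|v0] := eqVneq v 0; last first.
  have uv : h^T *m u = v%:M by rewrite [LHS]mx11_scalar.
  by rewrite !mulmxN uv mul_mx_scalar scalerA mulfV ?scale1r.
rewrite /u; have /sqnorm_eq0 -> : ((sigma^T *m h)^T *m (sigma^T *m h)) 0 0 = 0.
  by rewrite trmx_mul trmxK -!mulmxA.
by rewrite mulmx0 oppr0 mul0mx.
Qed.

Variables (sigma : 'M[R]_(n, K)) (S mu : 'cV[R]_n) (b : 'rV[R]_n) (r : R).
Hypotheses (bS_gt0 : 0 < (b *m S) 0 0) (bs0 : b *m sigma = 0)
  (bmuE : (b *m mu) 0 0 = r * (b *m S) 0 0).
Let e := mu - r *: S.
Variables (h : 'cV[R]_n).
Let f := e + sigma *m sigma^T *m h.
Hypothesis f0 : (sigma *m sigma^T)^T *m f = 0.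
(** The scalar is written as an entry of a 1x1 matrix product so that, over time, it is a process to
    which [adapted_measurableZ] applies. *)
Let Delta : 'rV[R]_n := f^T - (f^T *m S *m ((b *m S) 0 0)^-1%:M) 0 0 *: b.

(** [f] lies in the kernel of [sigma *m sigma^T], hence of [sigma^T]; the position in [b] carries no
    risk either. *)
Lemma residual_riskless : Delta *m sigma = 0.
Proof.
have sf0 : sigma^T *m f = 0.
  by apply: mulmx_tr_eq0; move: f0; rewrite trmx_mul trmxK.
rewrite mulmxBl -scalemxAl bs0 scaler0 subr0.
by apply: trmx_inj; rewrite trmx_mul trmxK sf0 trmx0.
Qed.

Let subZE (u v : 'M[R]_1) c : (u - c *: v) 0 0 = u 0 0 - c * v 0 0.
Proof. by rewrite !mxE. Qed.

Let DeltaE : Delta = f^T - ((f^T *m S) 0 0 / (b *m S) 0 0) *: b.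
Proof. by rewrite /Delta mul_mx_scalar [X in X *: b]mxE mulrC. Qed.

Lemma residual_value0 : Delta *m S = 0.
Proof.
apply/matrixP => i j; rewrite (ord1 i) (ord1 j) [RHS]mxE DeltaE mulmxBl.
by rewrite -scalemxAl subZE divfK ?gt_eqF// subrr.
Qed.

(** [f] is orthogonal to [f - e], so its squared norm is [f^T e]; the position in [b] earns [r] per
    unit of value, which accounts for the term [- r f^T S]. *)
Lemma residual_drift : (Delta *m mu) 0 0 = (f^T *m f) 0 0.
Proof.
have fE : f^T *m f = f^T *m mu - r *: (f^T *m S).
  rewrite [in X in _ *m X]/f mulmxDr [X in _ + X](_ : _ = 0); last first.
    by apply: trmx_inj; rewrite mulmxA trmx_mul trmx_mul trmxK f0 mulmx0 trmx0.
  by rewrite addr0 mulmxBr -scalemxAr.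
rewrite fE DeltaE mulmxBl -scalemxAl !subZE bmuE.
by rewrite mulrCA divfK ?gt_eqF.
Qed.

End PointwiseCAPM.

(** * From pointwise algebra to processes *)

Section CAPM.
Context d (Omega : measurableType d) (R : realType).
Variables (P : probability Omega R) (TT : set R) (F : R -> set (set Omega)).
Local Notation leb := (@lebesgue_measure R).
Local Notation process := (process R Omega).
Hypotheses (TT_interval : time_interval TT) (F_filtration : filtration TT F).
Context (N K : nat).
Variables (S mu : process N.+1 1) (sigma : process N.+1 K) (r : process 1 1).
Hypotheses (adS : adapted_measurable TT F S) (admu : adapted_measurable TT F mu)
  (adsigma : adapted_measurable TT F sigma) (adr : adapted_measurable TT F r).

Lemma measurable_gain_gt0 (Delta : process 1 N.+1) :
  adapted_measurable TT F Delta ->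
  measurable [set p : Omega * R |
    TT p.2 /\ 0 < (Delta p.2 p.1 *m mu p.2 p.1) 0 0].
Proof.
move=> adDelta.
have mTT : measurable ([set: Omega] `*` TT).
  by apply: measurableX => //; exact: measurable_time_interval.
have [_ mgain] := adapted_measurableM F_filtration adDelta admu.
rewrite [X in measurable X](_ : _ = ([set: Omega] `*` TT) `&` [set p |
    0 < (Delta p.2 p.1 *m mu p.2 p.1) 0 0]); last first.
  by apply/seteqP; split=> p /= [] // [].
exact: (measurable_set_gt0 mTT (mgain 0 0)).
Qed.

Lemma capm_arbitrage_free (Delta : process 1 N.+1) :
  capm_equation P TT S mu sigma r Delta ->
  instantaneously_arbitrage_free P TT F S mu sigma.
Proof.
move=> capm [Delta' [adDelta' riskless value0 _]]; apply/negP.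
rewrite -leNgt measure_le0; apply/eqP.
apply: measure_negligible; first exact: measurable_gain_gt0.
have := ae_productI capm (ae_productI riskless value0).
apply: negligibleS => p /= [Tp gain_gt0] /(_ Tp) [eE [riskless_p value0_p]].
move: gain_gt0; suff -> : Delta' p.2 p.1 *m mu p.2 p.1 = 0 by rewrite mxE ltxx.
(* The right-hand side of the CAPM equation is a multiple of the betas, so [Delta'] annihilates the
   excess drift. *)
have : Delta' p.2 p.1 *m (mu p.2 p.1 - r p.2 p.1 0 0 *: S p.2 p.1) = 0.
  by rewrite eE mulmxA (riskless_mul_betas _ riskless_p) mul0mx.
by rewrite mulmxBr -scalemxAr value0_p scaler0 subr0.
Qed.

Lemma arbitrage_free_capm (b : process 1 N.+1) :
  adapted_measurable TT F b ->
  ae_product P TT (fun t w => 0 < (b t w *m S t w) 0 0) ->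
  ae_product P TT (fun t w => b t w *m sigma t w = 0) ->
  ae_product P TT (fun t w =>
    (b t w *m mu t w) 0 0 = r t w 0 0 * (b t w *m S t w) 0 0) ->
  instantaneously_arbitrage_free P TT F S mu sigma ->
  exists Delta : process 1 N.+1,
    adapted_measurable TT F Delta /\ capm_equation P TT S mu sigma r Delta.
Proof.
move=> adb M_gt0 bs0 bmuE no_arbitrage.
have [phi [phiP mphi]] :=
  adapted_measurable_least_squares F_filtration N.+1 N.+1.
pose e t w := mu t w - r t w 0 0 *: S t w.
(* Regressing on [sigma sigma^T] instead of [sigma] makes the coefficients [h] a portfolio, with one
   entry per security; the column space is the same. *)
pose A t w := sigma t w *m (sigma t w)^T.
pose h t w := phi (A t w) (e t w).
pose f t w := e t w + A t w *m h t w.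
pose Delta t w : 'rV[R]_N.+1 := (f t w)^T -
  ((f t w)^T *m S t w *m ((b t w *m S t w) 0 0)^-1%:M) 0 0 *: b t w.
have ade : adapted_measurable TT F e.
  by apply: adapted_measurableB => //; exact: adapted_measurableZ.
have adA : adapted_measurable TT F A.
  by apply: adapted_measurableM => //; exact: adapted_measurable_tr.
have adh : adapted_measurable TT F h by exact: mphi.
have adf : adapted_measurable TT F f.
  by apply: adapted_measurableD => //; exact: adapted_measurableM.
have adfT := adapted_measurable_tr F_filtration adf.
have adDelta : adapted_measurable TT F Delta.
  apply: adapted_measurableB => //.
  apply: (@adapted_measurableZ _ _ _ _ _ F_filtration _ _
    (fun t w => (f t w)^T *m S t w *m ((b t w *m S t w) 0 0)^-1%:M)) => //.
  apply: adapted_measurableM => //; first exact: adapted_measurableM.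
  by apply: adapted_measurableV => //; exact: adapted_measurableM.
exists (fun t w => (h t w)^T); split; first exact: adapted_measurable_tr.
have gainE : ae_product P TT (fun t w =>
    (Delta t w *m mu t w) 0 0 = ((f t w)^T *m f t w) 0 0).
  move: (ae_productI M_gt0 (ae_productI bs0 bmuE)).
  apply: ae_productS => t w _ [M0 [_ bmu]]; exact: residual_drift.
pose gains := [set p : Omega * R |
  TT p.2 /\ 0 < (Delta p.2 p.1 *m mu p.2 p.1) 0 0].
have : ((P \x leb)%E gains = 0)%E.
  (* If the gain set had positive measure, [Delta] would be an arbitrage, its drift being almost
     everywhere the squared norm of [f]. *)
  apply/eqP; rewrite -measure_le0 leNgt; apply/negP => gains_gt0.
  apply: no_arbitrage; exists Delta; split=> //.
  - move: bs0; apply: ae_productS => t w _ bs; exact: residual_riskless.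
  - move: M_gt0; apply: ae_productS => t w _ M0; exact: residual_value0.
  - by move: gainE; apply: ae_productS => t w _ ->; exact: sqnorm_ge0.
move=> gains0.
have no_gain : ae_product P TT (fun t w => ~ 0 < (Delta t w *m mu t w) 0 0).
  exists gains; split=> //; first exact: measurable_gain_gt0.
  by move=> p /= /not_implyP[Tp /contrapT gain_p].
move: (ae_productI gainE no_gain); apply: ae_productS => t w _ [gE /negP].
(* The squared norm of [f] is not positive, so [f = 0], which is what [betas_span] asks of [h]. *)
rewrite gE -leNgt => f_le0; apply: betas_span; apply: sqnorm_eq0.
by apply/eqP; rewrite eq_le f_le0 sqnorm_ge0.
Qed.

End CAPM.

Theorem theorem1 (R : realType) (d : measure_display)
  (Omega : measurableType d) (P : probability Omega R)
  (TT : set R) (F : R -> set (set Omega))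
  (N K : nat) (W : process R Omega K 1)
  (S D mu : process R Omega N.+1 1) (sigma : process R Omega N.+1 K)
  (b : process R Omega 1 N.+1) (r : process R Omega 1 1)
  (complete_P : measure_is_complete P)
  (TT_interval : time_interval TT)
  (F_filtration : filtration TT F)
  (W_wiener : wiener_process P TT F W)
  (model : securities_market_model P TT F W S D mu sigma)
  (b_mma : money_market_account P TT F W S mu sigma b)
  (r_rate : interest_rate_process P TT F S b r)
  (D_int : dividends_in_calL_inv P TT F W S D b) :
  instantaneously_arbitrage_free P TT F S mu sigma <->
  exists Delta : process R Omega 1 N.+1,
    trading_strategy TT F Delta /\ capm_equation P TT S mu sigma r Delta.
Proof.
have [adS _ _ [[admu _] [adsigma _] _]] := model.
have [adb _ M_gt0 bs0] := b_mma; have [[adr _] _] := r_rate.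
split=> [|[Delta [_ capm]]]; last exact: capm_arbitrage_free capm.
apply: (arbitrage_free_capm TT_interval F_filtration adS admu adsigma adr adb).
- exact: ae_product_of_ae.
- exact: bs0.
- exact: (money_market_account_drift complete_P TT_interval F_filtration adS
    b_mma r_rate).
Qed.
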